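(* Let $m$ be a positive integer and $q=2^m$. Let $u\in\mathbb{F}_q$ with $\mathrm{Tr}_2^q(u)=1$, let $\alpha\in\mathbb{F}_{q^2}$ be a root of $x^2+x+u$ (so $\{1,\alpha\}$ is a basis of $\mathbb{F}_{q^2}$ over $\mathbb{F}_q$), and let $\delta,\gamma\in\mathbb{F}_{q^2}$ with $\gamma\neq0$, written as $\delta=a+b\alpha$, $\gamma=c+d\alpha$ with $a,b,c,d\in\mathbb{F}_q$ (so that $\mathrm{Tr}_q^{q^2}(\delta)=b$, $\mathrm{Tr}_q^{q^2}(\gamma)=d$, $\mathrm{N}_q^{q^2}(\delta)=a^2+ab+b^2u$, $\mathrm{N}_q^{q^2}(\gamma)=c^2+cd+d^2u$). Then the polynomial $$f(x)=(x^q+x+\delta)^{2q+1}+\gamma x$$ is a permutation polynomial of $\mathbb{F}_{q^2}$ if and only if one of the following holds: (i) $\gamma\in\mathbb{F}_q^*$, and $b=0$ or $b^2=\gamma$; (ii) $\gamma\in\mathbb{F}_{q^2}^*\setminus\mathbb{F}_q$, $c=0$, $b^2u+b^2+du=0$ and $m$ is odd; (iii) $\gamma\in\mathbb{F}_{q^2}^*\setminus\mathbb{F}_q$, $c\neq0$, $b^2c^2+d\left(b^2(c+d+du)+c^2+cd+d^2u\right)=0$ and $m$ is odd.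
   Context: A polynomial over a finite field $\mathbb{F}$ is a permutation polynomial of $\mathbb{F}$ if the map it induces on $\mathbb{F}$ is a bijection. $\mathrm{Tr}_2^q(u)=u+u^2+u^{2^2}+\cdots+u^{2^{m-1}}$ for $u\in\mathbb{F}_q$; for $x\in\mathbb{F}_{q^2}$, $\mathrm{Tr}_q^{q^2}(x)=x+x^q$ and $\mathrm{N}_q^{q^2}(x)=x^{q+1}$. *)

(* Defs.v *)
From mathcomp Require Import all_boot all_order all_algebra.

Set Implicit Arguments.
Unset Strict Implicit.
Unset Printing Implicit Defensive.

Import GRing.Theory.
Local Open Scope ring_scope.

Definition permutation_poly (F : finFieldType) (p : {poly F}) : Prop :=
  bijective (fun x : F => p.[x]).

(* For u in the subfield of order 2 ^ m, this is the absolute trace of u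
   from that subfield to the field with two elements. *)
Definition abs_trace2 (F : finFieldType) (m : nat) (u : F) : F :=
  \sum_(i < m) u ^+ (2 ^ i).

(* K, a set of elements of the ambient field F, is a subfield of order q:
   the copy of the field with q elements inside F. *)
Definition subfield_of_order (F : finFieldType) (K : {set F}) (q : nat) : Prop :=
  GRing.divring_closed K /\ #|K| = q.

(* Main.v *)
Require Import Defs.
From mathcomp Require Import all_boot all_order all_algebra.
From mathcomp Require Import finfield ring zify.

Set Implicit Arguments.
Unset Strict Implicit.
Unset Printing Implicit Defensive.

Import GRing.Theory.
Local Open Scope ring_scope.

(** Write [x = X + Y * alpha] with [X], [Y] in [Fq].  Since
    [x ^+ q + x = Y], the two coordinates of [f x] are affine in [X], with
    linear coefficients [c] and [d].  Eliminating [X] shows that [f] permutes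
    [L] iff a polynomial in [Y] alone permutes [Fq]: this is
    [b Y^2 + (b^2 + c) Y] up to an affine change of variable if [d = 0], and
    [Y^3 + A Y] if [d != 0], where [d^2 A] is the left-hand side in (iii).
    The first is additive, so only its kernel matters.  The second has the
    roots [0] and [A^(1/2)], so it is injective only if [A = 0], and cubing
    permutes [Fq] iff [3] does not divide [2^m - 1]. *)

(** Multiplication by a nonzero [x] permutes [K :\ 0], so the product of all nonzero elements is
    multiplied by [x ^+ #|K :\ 0|] and yet unchanged. *)
Lemma subfield_expf_card (L : finFieldType) (K : {set L})
    (hK : GRing.divring_closed K) (x : L) : x \in K -> x ^+ #|K| = x.
Proof.
move=> Kx; have [_ KM] := GRing.subring_closedM hK.
have [K1 KB Kdiv] := hK.
have K0 : 0 \in K by rewrite -(subrr 1) KB.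
have cardK : #|K| = #|K :\ 0|.+1 by rewrite (cardsD1 0) K0.
have [->|x0] := eqVneq x 0; first by rewrite cardK expr0n.
have nz : \prod_(y in K :\ 0) y != 0.
  by apply/prodf_neq0 => y; rewrite !inE => /andP[].
have xK : [set x * y | y in K :\ 0] = K :\ 0.
  apply/setP => z; apply/imsetP/idP => [[y]|].
    by rewrite !inE => /andP[y0 Ky] ->; rewrite mulf_neq0 //= KM.
  rewrite !inE => /andP[z0 Kz]; exists (z / x); last by rewrite mulrC divfK.
  by rewrite !inE mulf_neq0 ?invr_eq0 //= Kdiv.
have: \prod_(y in K :\ 0) y = x ^+ #|K :\ 0| * \prod_(y in K :\ 0) y.
  rewrite -{1}xK big_imset /=; last by move=> y z _ _ /(mulfI x0).
  by rewrite big_split /= prodr_const.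
move/eqP; rewrite -[X in X == _]mul1r => /eqP/(mulIf nz) eq1.
by rewrite cardK exprS -eq1 mulr1.
Qed.

(** Each squaring replaces [alpha] by [alpha + u] and shifts the partial trace. With trace 1 this
    gives [alpha ^+ q = alpha + 1], whence [alpha] lies outside [Fq]. *)
Lemma artin_schreier_expr2 (L : finFieldType) (u alpha : L) (n : nat) :
  2 \in [pchar L] -> alpha ^+ 2 = alpha + u ->
  alpha ^+ (2 ^ n) = alpha + abs_trace2 n u.
Proof.
move=> ch2 ha; rewrite /abs_trace2; elim: n => [|n IHn].
  by rewrite big_ord0 addr0.
rewrite big_ord_recl expnSr exprM {}IHn -(pFrobenius_autE ch2) rmorphD rmorph_sum.
rewrite /= pFrobenius_autE ha addrA expr1; congr (_ + _).
by apply: eq_bigr => i _; rewrite pFrobenius_autE -exprM -expnSr.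
Qed.

Lemma cube_injective_subfield (L : finFieldType) (K : {set L}) (m : nat)
    (hK : GRing.divring_closed K) (cardK : #|K| = (2 ^ m)%N) (m_gt0 : (0 < m)%N) :
  {in K &, injective (fun t => t ^+ 3)} <-> odd m.
Proof.
have [_ KM] := GRing.subring_closedM hK.
have [K1 KB Kdiv] := hK.
have K0 : 0 \in K by rewrite -(subrr 1) KB.
have mod3 : (2 ^ m = (odd m).+1 %[mod 3])%N.
  rewrite -[in LHS](odd_double_half m) expnD -mul2n expnM -modnMmr -modnXm.
  by rewrite exp1n; case: odd.
split=> [injK | odd_m x y Kx Ky /= exy].
  apply: contraT => even_m; move: mod3; rewrite (negbTE even_m) => mod3.
  (* If cubing were injective, each of the [3 * k] nonzero elements would be a cube [t ^+ 3], hence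
     a root of ['X^k - 1]: more roots than the degree allows. *)
  pose k := ((2 ^ m).-1 %/ 3)%N.
  have q_gt1 : (1 < 2 ^ m)%N by rewrite -{1}(expn0 2) ltn_exp2l.
  have k3 : (3 * k).+1 = (2 ^ m)%N by rewrite /k; lia.
  have k_gt0 : (0 < k)%N by lia.
  have imK : [set t ^+ 3 | t in K] = K.
    apply/eqP; rewrite eqEcard card_in_imset // leqnn andbT.
    by apply/subsetP => _ /imsetP[t Kt ->]; rewrite !exprS expr0 mulr1 !KM.
  have cardK' : #|K| = #|K :\ 0|.+1 by rewrite (cardsD1 0) K0.
  have roots : all (root ('X^k - 1)) (enum (K :\ 0)).
    apply/allP => x; rewrite mem_enum !inE => /andP[x0].
    rewrite -{1}imK => /imsetP[t Kt xt]; rewrite /root !hornerE xt -exprM.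
    have t0 : t != 0 by apply: contraNneq x0 => t0; rewrite xt t0 expr0n.
    rewrite subr_eq0; apply/eqP/(mulfI t0); rewrite -exprS k3 mulr1 -cardK.
    exact: subfield_expf_card.
  have sizeX : size ('X^k - 1 : {poly L}) = k.+1 by rewrite size_XnsubC.
  have nz : 'X^k - 1 != 0 :> {poly L} by rewrite -size_poly_eq0 sizeX.
  have := max_poly_roots nz roots (enum_uniq _).
  rewrite sizeX -cardE; lia.
rewrite odd_m in mod3.
have [y0|y0] := eqVneq y 0.
  have /eqP : x ^+ 3 = 0 by rewrite exy y0 expr0n.
  by rewrite y0 expf_eq0 /= => /eqP.
have z3 : (x / y) ^+ 3 = 1 by rewrite expr_div_n exy divff // expf_neq0.
(* The quotient [z = x / y] satisfies [z ^+ 3 = 1] and [z ^+ (2 ^ m) = z]; since [2 ^ m] is 2 modulo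
   3, [z ^+ 2 = z]. *)
have := subfield_expf_card hK (Kdiv _ _ Kx Ky).
rewrite cardK (divn_eq (2 ^ m) 3) mod3 mulnC exprD exprM z3 expr1n mul1r.
rewrite [(2 %% 3)%N]/= expr2 => zz.
have z0 : x / y != 0.
  by apply/eqP => z0; move/eqP: z3; rewrite z0 expr0n eq_sym oner_eq0.
by rewrite -(divfK y0 x) (mulfI z0 (etrans zz (esym (mulr1 _)))) mul1r.
Qed.

(* [ring] does not normalize coefficients modulo 2, so identities in
   characteristic 2 are proved with an explicit witness [e]. *)
Lemma eq_modulo_two (R : nzRingType) (e x y : R) :
  2 = 0 :> R -> x = y + 2 * e -> x = y.
Proof. by move=> two0 ->; rewrite two0 mul0r addr0. Qed.

Lemma depressed_cubic_injective_subfield (L : finFieldType) (K : {set L})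
    (m : nat) (A : L) (hK : GRing.divring_closed K)
    (cardK : #|K| = (2 ^ m)%N) (m_gt0 : (0 < m)%N) :
  2 = 0 :> L -> A \in K ->
  {in K &, injective (fun t => t ^+ 3 + A * t)} <-> A = 0 /\ odd m.
Proof.
move=> two0 KA; rewrite -(cube_injective_subfield hK cardK m_gt0).
split=> [inj | [-> inj] x y Kx Ky /=]; last by rewrite !mul0r !addr0; apply: inj.
suff A0 : A = 0.
  by split=> // x y Kx Ky /= e; apply: inj => //; rewrite A0 !mul0r !addr0.
have [[K1 KB _] [_ KM]] := (hK, GRing.subring_closedM hK).
have KX n x : x \in K -> x ^+ n \in K.
  by move=> Kx; elim: n => [|n IH]; rewrite ?expr0 // exprS KM.
have K0 : 0 \in K by rewrite -(subrr 1) KB.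
(* The square root of [A] in [K]: squaring [B] gives [A ^+ (2 ^ m) = A]. *)
pose B := A ^+ (2 ^ m.-1).
have B2 : B ^+ 2 = A.
  by rewrite /B -exprM -expnSr prednK // -cardK subfield_expf_card.
have B0 : B = 0.
  apply: inj => //; first exact: KX.
  by apply: (eq_modulo_two (e := B ^+ 3) two0); rewrite /= -B2; ring.
by rewrite -B2 B0 expr0n.
Qed.

Theorem theorem3p19 (m q : nat) (hm : (0 < m)%N) (hq : q = (2 ^ m)%N)
    (L : finFieldType) (hL : #|L| = (q ^ 2)%N)
    (Fq : {set L}) (hFq : subfield_of_order Fq q)
    (u : L) (hu : u \in Fq) (htr : abs_trace2 m u = 1)
    (alpha : L) (halpha : root ('X^2 + 'X + u%:P) alpha)
    (a b c d : L) (ha : a \in Fq) (hb : b \in Fq) (hc : c \in Fq) (hd : d \in Fq)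
    (delta gamma : L) (hdelta : delta = a + b * alpha)
    (hgamma : gamma = c + d * alpha) (hgamma0 : gamma != 0) :
  permutation_poly
    (('X^q + 'X + delta%:P) ^+ (2 * q + 1) + gamma%:P * 'X) <->
  [\/ (gamma \in Fq /\ gamma != 0) /\ (b = 0 \/ b ^+ 2 = gamma),
      [/\ gamma != 0 /\ gamma \notin Fq, c = 0,
          b ^+ 2 * u + b ^+ 2 + d * u = 0 & odd m]
    | [/\ gamma != 0 /\ gamma \notin Fq, c != 0,
          b ^+ 2 * c ^+ 2
            + d * (b ^+ 2 * (c + d + d * u) + c ^+ 2 + c * d + d ^+ 2 * u) = 0
        & odd m] ].
Proof.
have [hK cardK] := hFq; rewrite hq in cardK.
have ch2 : 2 \in [pchar L].
  by apply: (@card_finPcharP _ 2 (m * 2)) => //; rewrite hL hq expnM.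
have two0 : 2 = 0 :> L by apply: pcharf0.
have [_ KM] := GRing.subring_closedM hK.
have [K0 KD] := GRing.zmod_closedD (GRing.subring_closedB hK).
have [K1 KB Kdiv] := hK.
have KX n x : x \in Fq -> x ^+ n \in Fq.
  by move=> Kx; elim: n => [|n IH]; rewrite ?expr0 // exprS KM.
have ha2 : alpha ^+ 2 = alpha + u.
  move: halpha; rewrite /root !hornerE => /eqP r0.
  apply: (eq_modulo_two (e := - (alpha + u)) two0).
  by rewrite -[LHS]subr0 -r0; ring.
have haq : alpha ^+ q = alpha + 1.
  by rewrite hq (artin_schreier_expr2 _ ch2 ha2) htr.
have Kalpha : alpha \notin Fq.
  apply/negP => Ka; have := subfield_expf_card hK Ka; rewrite cardK -hq haq.
  by move/eqP; rewrite -subr_eq0 addrC addKr oner_eq0.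
have Kcoord x y : x \in Fq -> y \in Fq -> x + y * alpha \in Fq -> y = 0.
  move=> Kx Ky Kz; apply: contraNeq Kalpha => y0.
  have -> : alpha = (x + y * alpha - x) / y by rewrite addrC addKr mulrC mulKf.
  by rewrite Kdiv // KB.
have coord_inj x y x' y' : x \in Fq -> y \in Fq -> x' \in Fq -> y' \in Fq ->
    x + y * alpha = x' + y' * alpha -> x = x' /\ y = y'.
  move=> Kx Ky Kx' Ky' e.
  have /eqP : y - y' = 0.
    apply: (Kcoord 0); rewrite ?KB //.
    have -> : 0 + (y - y') * alpha = x + y * alpha - x - y' * alpha by ring.
    by rewrite e [X in X - _ * _]addrAC addrK KB.
  by rewrite subr_eq0 => /eqP yy; move: e; rewrite yy => /addIr.
have coord_surj z : exists x y, [/\ x \in Fq, y \in Fq & z = x + y * alpha].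
  pose h (p : L * L) := p.1 + p.2 * alpha.
  have : z \in [set h p | p in setX Fq Fq].
    suff -> : [set h p | p in setX Fq Fq] = setT by rewrite inE.
    apply/eqP; rewrite eqEcard subsetT cardsT hL card_in_imset.
      by rewrite cardsX cardK hq mulnn /=.
    move=> [x y] [x' y']; rewrite !inE /= => /andP[Kx Ky] /andP[Kx' Ky'] e.
    by have [-> ->] := coord_inj _ _ _ _ Kx Ky Kx' Ky' e.
  by case/imsetP => -[x y]; rewrite inE => /andP[Kx Ky] ->; exists x, y.
set f := (X in permutation_poly X).
(* [N y] is the norm of [w = (y + a) + b * alpha], so [w ^+ (2 * q + 1)] is [N y] times the
   conjugate [(y + a + b) + b * alpha]. Then [f0] and [f1] are the coordinates of the value of
   [f]. *)
pose N y := (y + a) ^+ 2 + (y + a) * b + b ^+ 2 * u.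
pose f0 x y := N y * (y + a + b) + c * x + d * u * y.
pose f1 x y := N y * b + c * y + d * x + d * y.
have KN y : y \in Fq -> N y \in Fq.
  by move=> Ky; rewrite !(KD, KM, KX).
have Kf0 x y : x \in Fq -> y \in Fq -> f0 x y \in Fq.
  by move=> Kx Ky; rewrite !(KD, KM, KN).
have Kf1 x y : x \in Fq -> y \in Fq -> f1 x y \in Fq.
  by move=> Kx Ky; rewrite !(KD, KM, KN).
have p2 k : [pchar L].-nat (2 ^ k)%N.
  by rewrite pnatX (eq_pnat _ (pcharf_eq ch2)) pnat_id.
have fixq x : x \in Fq -> x ^+ q = x.
  by move=> Kx; rewrite hq -cardK subfield_expf_card.
have fE x y : x \in Fq -> y \in Fq ->
    f.[x + y * alpha] = f0 x y + f1 x y * alpha.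
  move=> Kx Ky; rewrite /f !(hornerD, hornerM, horner_exp, hornerX, hornerC).
  have powq z t : z \in Fq -> t \in Fq ->
      (z + t * alpha) ^+ q = z + t * (alpha + 1).
    by move=> Kz Kt; rewrite hq (exprDn_pchar _ _ (p2 m)) exprMn -hq haq !fixq.
  rewrite (powq _ _ Kx Ky).
  have -> : x + y * (alpha + 1) + (x + y * alpha) + delta = (y + a) + b * alpha.
    by apply: (eq_modulo_two (e := x + y * alpha) two0); rewrite hdelta; ring.
  rewrite exprD expr1 mulnC exprM powq ?KD // hgamma /f0 /f1 /N.
  pose e := (y + a + b) * b * alpha * (y + a + b + b * alpha).
  by apply: (eq_modulo_two (e := e) two0); rewrite /e; ring: ha2.
have permP : permutation_poly f <->
    (forall x y x' y', x \in Fq -> y \in Fq -> x' \in Fq -> y' \in Fq ->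
       f0 x y = f0 x' y' -> f1 x y = f1 x' y' -> x = x' /\ y = y').
  split=> [/bij_inj inj x y x' y' Kx Ky Kx' Ky' e0 e1 | inj].
    by apply: coord_inj => //; apply: inj; rewrite !fE // e0 e1.
  apply: injF_bij => z z'.
  have [x [y [Kx Ky ->]]] := coord_surj z.
  have [x' [y' [Kx' Ky' ->]]] := coord_surj z'.
  rewrite !fE // => /coord_inj[||||e0 e1]; rewrite ?Kf0 ?Kf1 //.
  by have [-> ->] := inj _ _ _ _ Kx Ky Kx' Ky' e0 e1.
have [d0|d0] := eqVneq d 0.
  have gc : gamma = c by rewrite hgamma d0 mul0r addr0.
  have c0 : c != 0 by rewrite -gc.
  have Kg : gamma \in Fq by rewrite gc.
  transitivity (b = 0 \/ b ^+ 2 = gamma); last first.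
    split=> [?|[[_ //]|[[_ /negP]]|[[_ /negP]]]] //.
    by constructor 1; split.
  rewrite permP gc.
  have f1E x y : f1 x y = b * y ^+ 2 + (b ^+ 2 + c) * y
      + b * (a ^+ 2 + a * b + b ^+ 2 * u).
    by apply: (eq_modulo_two (e := a * b * y) two0); rewrite /f1 /N d0; ring.
  split=> [inj | hb2 x y x' y' Kx Ky Kx' Ky' e0 e1].
    have [->|b0] := eqVneq b 0; [by left | right].
    (* This [y] is the other root of the additive part of [f1], and [x] is chosen to make [f0] agree
       as well; the collision with the origin forces [y = 0]. *)
    pose y := (b ^+ 2 + c) / b.
    have Ky : y \in Fq by rewrite Kdiv ?KD ?KX.
    have by_ : b * y = b ^+ 2 + c by rewrite mulrC divfK.
    pose x := (f0 0 0 - f0 0 y) / c.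
    have Kx : x \in Fq by rewrite Kdiv ?KB ?Kf0.
    have cx : c * x = f0 0 0 - f0 0 y by rewrite mulrC divfK.
    have [||_ y0] := inj x y 0 0 Kx Ky K0 K0.
    - have -> : f0 x y = f0 0 y + c * x by rewrite /f0; ring.
      by rewrite cx addrC subrK.
    - rewrite !f1E -by_.
      by apply: (eq_modulo_two (e := b * y ^+ 2) two0); ring.
    apply/eqP; rewrite -subr_eq0 (oppr_pchar2 ch2) -by_ y0 mulr0; exact: eqxx.
  have yy : y = y'.
    apply/eqP; move: e1; rewrite !f1E.
    (* Up to a constant, [f1] is [c * y] in the first case and [b * y ^+ 2] in the second, where
       squaring is injective in characteristic 2. *)
    case: hb2 => [->|].
      by rewrite expr0n !mul0r !add0r !addr0 => /(mulfI c0) ->.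
    move=> bc; have b0 : b != 0 by apply: contraNneq c0 => b0; rewrite -bc b0 expr0n.
    rewrite bc -mulr2n -mulr_natl two0 !mul0r !addr0 => /addIr/(mulfI b0)/eqP.
    by rewrite eqf_sqr (oppr_pchar2 ch2) orbb.
  split=> //; apply: (mulfI c0); move: e0; rewrite /f0 -yy.
  by move/addIr/addrI.
(* In [s = y + a], the combination [d * f0 + c * f1] is [d * (s ^+ 3 + r * s ^+ 2 + e * s)] plus a
   constant: the [x] terms cancel in characteristic 2. The shift by [r] removes the quadratic term,
   as 3 = 1, and leaves the linear coefficient [A]. Here [n] is the norm of [gamma]. *)
pose r := b * c / d.
pose n := c ^+ 2 + c * d + d ^+ 2 * u.
pose e := (b ^+ 2 * u * d + b ^+ 2 * d + b ^+ 2 * c + n) / d.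
pose A := r ^+ 2 + e.
have rE : d * r = b * c by rewrite mulrC divfK.
have eE : d * e = b ^+ 2 * u * d + b ^+ 2 * d + b ^+ 2 * c + n.
  by rewrite mulrC divfK.
have AE : d ^+ 2 * A = b ^+ 2 * c ^+ 2
    + d * (b ^+ 2 * (c + d + d * u) + c ^+ 2 + c * d + d ^+ 2 * u).
  have -> : d ^+ 2 * A = (d * r) ^+ 2 + d * (d * e) by rewrite /A; ring.
  by rewrite rE eE /n; ring.
pose C := b ^+ 2 * u * (d * b + b * c) - n * a - d * e * r.
have elimX x y : d * f0 x y + c * f1 x y =
    d * ((y + a + r) ^+ 3 + A * (y + a + r)) + C.
  pose s := y + a.
  pose E := c * d * x + b * d * s ^+ 2 - b * c * s ^+ 2
    - 2 * b * c * r * s - b * c * r ^+ 2.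
  apply: (eq_modulo_two (e := E) two0); rewrite /f0 /f1 /N /A /E /C /s.
  (* Exposing the products [d * r] and [d * e] lets [rE] and [eE] clear the denominators. *)
  have -> : d * ((y + a + r) ^+ 3 + (r ^+ 2 + e) * (y + a + r)) =
      d * (y + a) ^+ 3 + d * r * (3 * (y + a) ^+ 2 + 4 * r * (y + a) + 2 * r ^+ 2)
      + d * e * (y + a + r) by ring.
  by rewrite rE eE /n; ring.
have Kr : r \in Fq by rewrite Kdiv ?KM.
have KA : A \in Fq.
  by rewrite /A /e /n !(KD, KX, Kdiv, KM).
have permA : permutation_poly f <-> A = 0 /\ odd m.
  rewrite -(depressed_cubic_injective_subfield hK cardK hm two0 KA) permP.
  split=> [inj t t' Kt Kt' /= ett | inj x y x' y' Kx Ky Kx' Ky' e0 e1].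
    pose y := t - a - r; pose y' := t' - a - r.
    have Ky : y \in Fq by rewrite !KB.
    have Ky' : y' \in Fq by rewrite !KB.
    (* Since [d != 0], [x] can be tuned so that [f1] agrees at [(x, y)] and [(0, y')]; equal cubic
       values then make [f0] agree too. *)
    pose x := (f1 0 y' - f1 0 y) / d.
    have Kx : x \in Fq by rewrite Kdiv ?KB ?Kf1.
    have f1E : f1 x y = f1 0 y'.
      have -> : f1 x y = f1 0 y + d * x by rewrite /f1; ring.
      by rewrite [d * _]mulrC divfK // addrC subrK.
    have tE z : z - a - r + a + r = z by ring.
    have : d * f0 x y + c * f1 x y = d * f0 0 y' + c * f1 0 y'.
      by rewrite !elimX !tE ett.
    rewrite f1E => /addIr/(mulfI d0) f0E.
    have [_ yy] := inj _ _ _ _ Kx Ky K0 Ky' f0E f1E.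
    by rewrite -(tE t) -(tE t') -/y -/y' yy.
  have yy : y = y'.
    apply/(addIr a)/(addIr r); apply: inj; rewrite ?KD //=.
    by apply/(mulfI d0)/(addIr C); rewrite -(elimX x) -(elimX x') e0 e1.
  by split=> //; move: e1; rewrite /f1 yy => /addIr/addrI/(mulfI d0).
have Kg : gamma \notin Fq.
  by apply: contra_neqN d0; rewrite hgamma; apply: Kcoord.
have A0E : A = 0 <-> d ^+ 2 * A = 0.
  by split=> [->|/eqP]; rewrite ?mulr0 // mulf_eq0 expf_eq0 (negbTE d0) => /eqP.
rewrite permA A0E AE; split=> [[A0 odd_m] | ].
  (* For [c = 0] the left-hand side of (iii) is [d ^+ 2] times that of (ii). *)
  have [c0|c0] := eqVneq c 0; [constructor 2 | constructor 3]; split=> //.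
  apply: (mulfI (expf_neq0 2 d0)); rewrite mulr0 -[RHS]A0 c0; ring.
case=> [[[Kg' _] _]|[_ c0 e0 odd_m]|[_ _ e0 odd_m]];
  [by rewrite Kg' in Kg | | by split].
split=> //; have := congr1 (fun z => d ^+ 2 * z) e0; rewrite mulr0 => <-.
by rewrite c0; ring.
Qed.
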